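(* Let $m$ be odd and let $G$ be either an abelian group of order $2m$ or the dihedral group of order $2m$. Let $\psi:G\times G\to\{\pm1\}$ be a normalized cocycle, and if $G$ is dihedral assume that $\psi$ is not a coboundary. Then $M_\psi=[\psi(g,h)]_{g,h\in G}$ (rows and columns indexed by the elements of $G$ in the same order) is normal, i.e. $M_\psi M_\psi^\top=M_\psi^\top M_\psi$.
   Context: A normalized cocycle satisfies $\psi(1,1)=1$ and $\psi(g,h)\psi(gh,k)=\psi(g,hk)\psi(h,k)$; a coboundary is one of the form $\partial\varphi(g,h)=\varphi(g)^{-1}\varphi(h)^{-1}\varphi(gh)$ with $\varphi:G\to\{\pm1\}$, $\varphi(1)=1$. *)

(* Defs.v *)
From HB Require Import structures.
From mathcomp Require Import all_boot all_order all_algebra.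
From mathcomp Require Import all_fingroup all_solvable.

Set Implicit Arguments.
Unset Strict Implicit.
Unset Printing Implicit Defensive.

Import GRing.Theory.
Local Open Scope ring_scope.

Definition is_sign (x : int) : Prop := x = 1 \/ x = -1.

Definition normalized_cocycle (gT : finGroupType) (psi : gT -> gT -> int) : Prop :=
  [/\ forall g h : gT, is_sign (psi g h),
      psi 1%g 1%g = 1 &
      forall g h k : gT,
        psi g h * psi (g * h)%g k = psi g (h * k)%g * psi h k].

Definition coboundary (gT : finGroupType) (phi : gT -> int) (g h : gT) : int :=
  (phi g)^-1 * (phi h)^-1 * phi (g * h)%g.

Definition is_coboundary (gT : finGroupType) (psi : gT -> gT -> int) : Prop :=
  exists phi : gT -> int,
    [/\ forall g : gT, is_sign (phi g),
        phi 1%g = 1 &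
        forall g h : gT, psi g h = coboundary phi g h].

(* [e] lists the elements of the group and fixes the common order of the rows *)
(* and columns.                                                               *)
Definition cocycle_mx (gT : finGroupType) (n : nat) (e : 'I_n -> gT)
    (psi : gT -> gT -> int) : 'M[int]_n :=
  \matrix_(i, j) psi (e i) (e j).

(* The library's [normalmx] uses the conjugate transpose, over a closed field. *)
Definition normal_mx (n : nat) (A : 'M[int]_n) : Prop :=
  A *m A^T = A^T *m A.

(* Main.v *)
Require Import Defs.
From HB Require Import structures.
From mathcomp Require Import all_boot all_order all_algebra.
From mathcomp Require Import all_fingroup all_solvable.
From mathcomp Require Import zify ring.

(** Let [C] be a subgroup of odd order and index 2, and put
    [phi g := \prod_(k in C) psi g k] and [chi g := \prod_k psi g k].
    Multiplying the cocycle identity over [k] in [C] shows that, up to the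
    coboundary of [phi], [psi g h] is [1] if [h] lies in [C] and [chi g]
    otherwise.  Multiplying it over all [k] shows that [chi] is a homomorphism
    to [{1, -1}]; it is trivial on [C], so it is either trivial, and [psi] is a
    coboundary, or the sign character with kernel [C].  If [G] is abelian, [psi]
    is therefore symmetric.  If [G] is dihedral and [chi] is the sign, the
    entries of the two products at [g, h] are compared by substitutions in the
    sums: both vanish if exactly one of [g, h] is a reflection, and otherwise
    they both reduce to the autocorrelation of [phi] at a rotation. *)

Set Implicit Arguments.
Unset Strict Implicit.
Unset Printing Implicit Defensive.

Import GRing.Theory.
Local Open Scope ring_scope.

(** * Signs and their powers *)

Lemma is_sign_mulss (x : int) : is_sign x -> x * x = 1.
Proof. by case=> ->. Qed.

Lemma is_signM (x y : int) : is_sign x -> is_sign y -> is_sign (x * y).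
Proof. by case=> -> [] ->; [left|right|right|left]. Qed.

Lemma is_sign_prod (I : finType) (P : pred I) (F : I -> int) :
  (forall i, is_sign (F i)) -> is_sign (\prod_(i | P i) F i).
Proof. by move=> sF; elim/big_ind: _ => //; [left | apply: is_signM]. Qed.

Lemma is_sign_expr_odd (x : int) n : is_sign x -> odd n -> x ^+ n = x.
Proof. by case=> ->; rewrite ?expr1n // -signr_odd => ->. Qed.

Lemma is_sign_expr_double (x : int) n : is_sign x -> x ^+ (2 * n) = 1.
Proof. by move=> sx; rewrite exprM expr2 is_sign_mulss ?expr1n. Qed.

(** * Cocycles on a group with a subgroup of odd order and index two *)

Section IndexTwo.

Variables (gT : finGroupType) (m : nat) (C : {group gT}).
Hypotheses (cardG : #|[set: gT]| = (2 * m)%N) (cardC : #|C| = m).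

Lemma mem_mul_index2 g h : (g * h \in C)%g = ((g \in C) == (h \in C)).
Proof.
have [Cg | C'g] := boolP (g \in C); first by rewrite groupMl.
have [Ch | C'h] := boolP (h \in C); first by rewrite groupMr // (negPf C'g).
(* For [g] outside [C], the coset of [g^-1] avoids [C] and has as many elements as its
   complement. *)
have /eqP eC : (g^-1 *: C == ~: C)%g.
  rewrite eqEcard card_lcoset cardC; apply/andP; split.
    apply/subsetP=> x; rewrite mem_lcoset invgK inE => Cgx.
    by apply: contra C'g => Cx; rewrite -(groupMr _ Cx).
  by have := cardsC C; rewrite -[#|gT|]cardsT cardG cardC; lia.
have : h \in (~: C) by rewrite inE.
by rewrite -eC mem_lcoset invgK => ->.
Qed.

Variable psi : gT -> gT -> int.
Hypotheses (odd_m : odd m) (cocycle_psi : normalized_cocycle psi).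

Let phi g := \prod_(k in C) psi g k.
Let chi g := \prod_k psi g k.

Let sign_psi g h : is_sign (psi g h). Proof. by case: cocycle_psi. Qed.
Let sign_phi g : is_sign (phi g). Proof. exact: is_sign_prod. Qed.
Let sign_chi g : is_sign (chi g). Proof. exact: is_sign_prod. Qed.

Let cocycleE g h k : psi g h * psi (g * h)%g k = psi g (h * k)%g * psi h k.
Proof. by case: cocycle_psi. Qed.

Lemma cocycle1g k : psi 1%g k = 1.
Proof.
case: cocycle_psi => _ psi11 _; have := cocycleE 1%g 1%g k.
by rewrite !mul1g psi11 mul1r => ->; apply: is_sign_mulss.
Qed.

Lemma chiM g h : chi (g * h)%g = chi g * chi h.
Proof.
have : \prod_k (psi g h * psi (g * h)%g k) = \prod_k (psi g (h * k)%g * psi h k).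
  by apply: eq_bigr => k _; apply: cocycleE.
rewrite !big_split /= prodr_const -[#|gT|]cardsT cardG.
rewrite is_sign_expr_double // mul1r -/(chi _) -/(chi _) => ->; congr (_ * _).
by rewrite /chi [RHS](reindex_inj (mulgI h)).
Qed.

Lemma chi1 : chi 1%g = 1.
Proof. by apply: big1 => k _; apply: cocycle1g. Qed.

(** As [m] is odd, [chi c] equals its [m]-th power, which is [chi (c ^+ m)], and [c ^+ m] is
    trivial. *)
Lemma chi_in c : c \in C -> chi c = 1.
Proof.
move=> Cc; rewrite -(is_sign_expr_odd (sign_chi c) odd_m).
have chiX n : chi (c ^+ n)%g = chi c ^+ n.
  by elim: n => [|n IHn]; rewrite ?expg0 ?chi1 // expgS exprS chiM IHn.
by rewrite -chiX -cardC expg_cardG // chi1.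
Qed.

Lemma cocycle_chi g h :
  psi g h = phi g * phi h * phi (g * h)%g * (if h \in C then 1 else chi g).
Proof.
have : \prod_(k in C) (psi g h * psi (g * h)%g k)
     = \prod_(k in C) (psi g (h * k)%g * psi h k).
  by apply: eq_bigr => k _; apply: cocycleE.
rewrite !big_split /= prodr_const cardC is_sign_expr_odd //.
rewrite -/(phi _) -/(phi _) => E.
have {}E : psi g h = \prod_(k in C) psi g (h * k)%g * phi h * phi (g * h)%g.
  by rewrite -E -mulrA is_sign_mulss // mulr1.
(* The product runs over the coset [h C]: this is [C] itself or its complement, where the product is
   [chi g] divided by the sign [phi g]. *)
rewrite E; have -> : \prod_(k in C) psi g (h * k)%g
                     = phi g * (if h \in C then 1 else chi g); last by ring.
have -> : \prod_(k in C) psi g (h * k)%g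
          = \prod_(k | (k \in C) == (h \in C)) psi g k.
  rewrite [RHS](reindex_inj (mulgI h)) /=; apply: eq_bigl => k.
  by rewrite mem_mul_index2; do 2!case: (_ \in C).
case: ifP => Ch.
  by rewrite mulr1; apply: eq_bigl => k; case: (_ \in C).
rewrite /chi [X in _ = _ * X](bigID (mem C)) /= -/(phi g) mulrA is_sign_mulss // mul1r.
by apply: eq_bigl => k; case: (_ \in C).
Qed.

Lemma cocycle_dichotomy :
  exists2 phi : gT -> int, forall g, is_sign (phi g) &
    [/\ is_coboundary psi & forall g h, psi g h = phi g * phi h * phi (g * h)%g]
    \/ (forall g h, psi g h = phi g * phi h * phi (g * h)%g
                     * (-1) ^+ ((g \notin C) && (h \notin C))).
Proof.
exists phi => //.
have [/forallP chiT | /forallPn[t chit]] := boolP [forall t, chi t == 1].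
  have E g h : psi g h = phi g * phi h * phi (g * h)%g.
    by rewrite cocycle_chi (eqP (chiT g)) if_same mulr1.
  (* Inversion on [int] computes to the identity, so [E] already has the form of a coboundary. *)
  left; split=> //; exists phi; split=> //.
  by apply: big1 => k _; apply: cocycle1g.
have chitN : chi t = -1 by case: (sign_chi t) chit => // ->; rewrite eqxx.
have C't : t \notin C by apply: contra chit => Ct; rewrite chi_in.
right=> g h; rewrite cocycle_chi; congr (_ * _).
have [Ch | C'h] /= := boolP (h \in C); first by rewrite andbF.
have [Cg | C'g] /= := boolP (g \in C); first exact: chi_in.
(* Now [chi t * chi g = 1] forces [chi g = -1]. *)
have Ctg : (t * g)%g \in C by rewrite mem_mul_index2 (negPf C't) (negPf C'g).
by have := chi_in Ctg; rewrite chiM chitN mulN1r => /eqP; rewrite eqr_oppLR => /eqP.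
Qed.

Lemma cocycle_sym_abelian : abelian [set: gT] -> forall g h, psi g h = psi h g.
Proof.
move=> /centsP abG g h; have gh : (g * h = h * g)%g by apply: abG; rewrite inE.
have [p _ [[_ E] | E]] := cocycle_dichotomy; rewrite !E gh 1?andbC; ring.
Qed.

(** * Row and column sums when all elements outside [C] are involutions *)

Section Dihedral.

Hypotheses (abelC : abelian C) (invol : forall t, t \notin C -> (t * t = 1)%g).

Let invE t : t \notin C -> (t^-1)%g = t.
Proof. by move=> /invol tt; apply/eqP; rewrite eq_invg_mul tt. Qed.

Let C_comm x y : x \in C -> y \in C -> (x * y = y * x)%g.
Proof. by move=> Cx Cy; apply: (centsP abelC). Qed.

(** On [C] the terms agree by commutativity. Off [C], substitute [c * k] for [k] on the right:
    [c * k] is an involution, so [c * k * c = k]. *)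
Lemma autocorrelation_sym (f : gT -> int) c : c \in C ->
  \sum_k f (c * k)%g * f k = \sum_k f (k * c)%g * f k.
Proof.
move=> Cc; rewrite (bigID (mem C)) [RHS](bigID (mem C)) /=; congr (_ + _).
  by apply: eq_bigr => k Ck; rewrite C_comm.
rewrite [RHS](reindex_inj (mulgI c)) /=.
apply: eq_big => k; first by rewrite groupMl.
move=> C'k; rewrite [RHS]mulrC; congr (f _ * f _).
rewrite -[LHS]mul1g -(@invol (c * k)%g); last by rewrite groupMl.
by rewrite -[LHS]mulgA -[(c * k * k)%g]mulgA invol // mulg1.
Qed.

(** Translating [k] by the reflection [g^-1 * h] on the left, or [h * g^-1] on the right, swaps the
    two values of [f] and flips the sign, so each sum is its own negative. *)
Lemma sum_dihedral_mixed (f : gT -> int) g h : g \in C -> h \notin C ->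
  \sum_k f (g * k)%g * f (h * k)%g * (-1) ^+ (k \notin C) = 0 /\
  \sum_k f (k * g)%g * f (k * h)%g * (-1) ^+ (k \notin C) = 0.
Proof.
move=> Cg C'h.
have C's : (g^-1 * h)%g \notin C by rewrite groupMl ?groupV.
have C't : (h * g^-1)%g \notin C by rewrite groupMr ?groupV.
have eq0 (S : int) : S = - S -> S = 0 by lia.
split; apply: eq0; rewrite -sumrN.
  rewrite (reindex_inj (mulgI (g^-1 * h)%g)); apply: eq_bigr => k _ /=.
  have -> : (g * (g^-1 * h * k) = h * k)%g by rewrite !mulgA mulgV mul1g.
  have -> : (h * (g^-1 * h * k) = g * k)%g.
    by rewrite -[in RHS](mulg1 g) -(invol C's) !mulgA mulgV mul1g.
  rewrite mem_mul_index2 (negPf C's) [f (h * k)%g * _]mulrC -mulrN.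
  by case: (k \in C).
rewrite (reindex_inj (mulIg (h * g^-1)%g)); apply: eq_bigr => k _ /=.
have -> : (k * (h * g^-1) * g = k * h)%g by rewrite !mulgA mulgKV.
have -> : (k * (h * g^-1) * h = k * g)%g.
  by rewrite -[in RHS](mulg1 k) -(invol C't) !mulgA mulgKV.
rewrite mem_mul_index2 (negPf C't) [f (k * h)%g * _]mulrC -mulrN.
by case: (k \in C).
Qed.

(** Both sums reduce to the autocorrelation of [f] at [g * h^-1], which lies in [C]. *)
Lemma sum_dihedral_same (f : gT -> int) g h : (g \in C) = (h \in C) ->
  \sum_k f (g * k)%g * f (h * k)%g = \sum_k f (k * g)%g * f (k * h)%g.
Proof.
move=> eqC.
have -> : \sum_k f (g * k)%g * f (h * k)%g = \sum_k f (g * h^-1 * k)%g * f k.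
  rewrite [RHS](reindex_inj (mulgI h)) /=.
  by apply: eq_bigr => k _; rewrite !mulgA mulgKV.
rewrite autocorrelation_sym ?mem_mul_index2 ?groupV ?eqC ?eqxx //.
have [Ch | C'h] := boolP (h \in C).
  rewrite [RHS](reindex_inj (mulIg h^-1%g)) /=; apply: eq_bigr => k _.
  by rewrite mulgKV -mulgA (C_comm (groupVr Ch)) ?eqC.
have C'g : g \notin C by rewrite eqC.
rewrite [RHS](reindex_inj (mulIg g^-1%g)) /=; apply: eq_bigr => k _.
by rewrite mulgKV mulrC !invE // !mulgA.
Qed.

Lemma cocycle_gram_dihedral : ~ is_coboundary psi ->
  forall g h, \sum_k psi g k * psi h k = \sum_k psi k g * psi k h.
Proof.
move=> ncob; have [f sf [[/ncob//] | E] g h] := cocycle_dichotomy.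
pose s x k : int := (-1) ^+ ((x \notin C) && (k \notin C)).
have -> : \sum_k psi g k * psi h k
        = f g * f h * \sum_k f (g * k)%g * f (h * k)%g * (s g k * s h k).
  rewrite big_distrr; apply: eq_bigr => k _ /=; rewrite !E -/(s g k) -/(s h k).
  have := is_sign_mulss (sf k); move: (f k) => x xx.
  (* The left side carries the factor [f k] twice; writing [1] as [x * x] supplies it on the
     right. *)
  by rewrite -[RHS]mul1r -xx; ring.
have -> : \sum_k psi k g * psi k h
        = f g * f h * \sum_k f (k * g)%g * f (k * h)%g * (s g k * s h k).
  rewrite big_distrr; apply: eq_bigr => k _ /=.
  rewrite !E (andbC (k \notin C)) (andbC (k \notin C)) -/(s g k) -/(s h k).
  have := is_sign_mulss (sf k); move: (f k) => x xx.
  by rewrite -[RHS]mul1r -xx; ring.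
congr (_ * _); rewrite /s.
(* The sign [s g k * s h k] is [1] if [g] and [h] lie on the same side of [C], and
   [(-1) ^+ (k \notin C)] otherwise. *)
have [Cg | C'g] := boolP (g \in C); have [Ch | C'h] := boolP (h \in C) => /=.
- under eq_bigr do rewrite !mulr1; under [RHS]eq_bigr do rewrite !mulr1.
  by apply: sum_dihedral_same; rewrite Cg Ch.
- under eq_bigr do rewrite mul1r; under [RHS]eq_bigr do rewrite mul1r.
  by have [-> ->] := sum_dihedral_mixed f Cg C'h.
- under eq_bigr do rewrite mulr1 [f _ * f _]mulrC.
  under [RHS]eq_bigr do rewrite mulr1 [f _ * f _]mulrC.
  by have [-> ->] := sum_dihedral_mixed f Ch C'g.
under eq_bigr do rewrite -expr2 sqrr_sign mulr1.
under [RHS]eq_bigr do rewrite -expr2 sqrr_sign mulr1.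
by apply: sum_dihedral_same; rewrite (negPf C'g) (negPf C'h).
Qed.

End Dihedral.

End IndexTwo.

(** * Existence of the subgroup of index two *)

Lemma abelian_odd_index2 (gT : finGroupType) m :
  odd m -> #|[set: gT]| = (2 * m)%N -> abelian [set: gT] ->
  exists C : {group gT}, #|C| = m.
Proof.
move=> odd_m cardG abG; exists 'O_(2%N)^'([set: gT])%G.
(* In a nilpotent group this core is a Hall subgroup, so its order is the odd part of [2 * m]. *)
rewrite (card_Hall (nilpotent_pcore_Hall _ (abelian_nil abG))) cardG.
rewrite partnM ?(odd_gt0 odd_m) // part_p'nat ?mul1n ?part_pnat_id //.
by rewrite p'natE // dvdn2 odd_m.
Qed.

Lemma dihedral_rotations (gT : finGroupType) m :
  (1 < m)%N -> #|[set: gT]| = (2 * m)%N -> [set: gT] \isog [set: 'D_(2 * m)] ->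
  exists C : {group gT},
    [/\ #|C| = m, abelian C & forall t, t \notin C -> (t * t = 1)%g].
Proof.
move=> m_gt1 cardG isoG.
have := isog_hom isoG.
rewrite mul2n (Grp_dihedral m_gt1) => /existsP[[x y]] /=.
case/eqP=> defG xm y2 xy.
have nxy : (<[y]> \subset 'N(<[x]>))%g.
  by rewrite cycle_subG; apply/normP; rewrite -cycleJ xy cycleV.
have prodG : (<[x]> * <[y]> = [set: gT])%g by rewrite -norm_joinEr.
exists <[x]>%G; split; last 1 first.
(* Write [t] as [x ^+ i * y ^+ j]; here [j] is odd, and conjugation by [y] inverts [x ^+ i]. *)
- move=> t C't; have : t \in (<[x]> * <[y]>)%g by rewrite prodG inE.
  case/mulsgP=> a b /cycleP[i ->] /cycleP[j ->] deft.
  have := C't; rewrite {t C't}deft groupMl ?mem_cycle //.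
  rewrite (divn_eq j 2) expgD mulnC expgM y2 expg1n mul1g modn2.
  case: (odd j) => /=; last by rewrite expg0 group1.
  move=> _; have yV : (y^-1 = y)%g by apply/eqP; rewrite eq_invg_mul -expg2 y2.
  have : (x ^+ i ^ y = (x ^+ i)^-1)%g by rewrite conjXg xy expVgn.
  by rewrite conjgE yV expg1 => E; rewrite -mulgA E mulgV.
(* The relations only bound the orders by [m] and [2]; since the product of the cyclic groups has
   [2 * m] elements, the bounds are attained. *)
- have ox : (#[x]%g <= m)%N by rewrite dvdn_leq ?(ltnW m_gt1) // order_dvdn xm.
  have oy : (#[y]%g <= 2)%N by rewrite dvdn_leq // order_dvdn y2.
  have := mul_cardG <[x]>%G <[y]>%G; rewrite /= prodG cardG -!orderE.
  have := cardG_gt0 (<[x]> :&: <[y]>)%G; rewrite /=.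
  by move: #|_|%g => k; nia.
exact: cycle_abelian.
Qed.

Theorem proposition6 (m : nat) (gT : finGroupType) (psi : gT -> gT -> int)
    (e : 'I_(2 * m) -> gT) :
  odd m ->
  #|[set: gT]| = (2 * m)%N ->
  bijective e ->
  normalized_cocycle psi ->
  (abelian [set: gT]
   \/ ([set: gT] \isog [set: 'D_(2 * m)] /\ ~ is_coboundary psi)) ->
  normal_mx (cocycle_mx e psi).
Proof.
move=> odd_m cardG bij_e coc hG.
suff gram g h : \sum_k psi g k * psi h k = \sum_k psi k g * psi k h.
  have bij_eP : {on [pred _ | true], bijective e} by apply: onW_bij.
  apply/matrixP=> i j; rewrite !mxE.
  have := gram (e i) (e j); rewrite (reindex e) // [RHS](reindex e) // => E.
  transitivity (\sum_k psi (e i) (e k) * psi (e j) (e k)).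
    by apply: eq_bigr => k _; rewrite !mxE.
  by rewrite E; apply: eq_bigr => k _; rewrite !mxE.
have abelian_case : abelian [set: gT] ->
    \sum_k psi g k * psi h k = \sum_k psi k g * psi k h.
  move=> abG; have [C cardC] := abelian_odd_index2 odd_m cardG abG.
  have sym := cocycle_sym_abelian cardG cardC odd_m coc abG.
  by apply: eq_bigr => k _; rewrite (sym g) (sym h).
case: hG => [// | [isoG ncob]].
(* The dihedral presentation requires [1 < m]; for [m = 1] the group has prime order 2 and is
   abelian. *)
have [m_le1 | m_gt1] := leqP m 1.
  apply: abelian_case; apply: cyclic_abelian; apply: prime_cyclic.
  by rewrite cardG; case: m odd_m m_le1 {e bij_e cardG isoG} => [|[]].
have [C [cardC abC invol]] := dihedral_rotations m_gt1 cardG isoG.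
exact: (cocycle_gram_dihedral cardG cardC odd_m coc abC invol ncob).
Qed.
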